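(* Let $B$ be a skyline board and let $B\cup m$ denote the skyline board obtained by adding a column of height $m$ to the right of $B$. Then $f_k(a,b;q,p;B)=0$ for $k<0$; $f_0(a,b;q,p;B)=1$ if $B$ is the empty board; and for every integer $k$, $$f_k(a,b;q,p;B\cup m)=W_{aq^{-2m},bq^{-m};q,p}(m)\,f_k(a,b;q,p;B)+[m]_{aq^{-2m},bq^{-m};q,p}\,f_{k-1}(a,b;q,p;B).$$
   Context: Theta functions: for $x\neq 0$ and $|p|<1$, $\theta(x;p)=\prod_{j\ge0}(1-p^jx)(1-p^{j+1}/x)$, $\theta(x_1,\dots,x_m;p)=\prod_l\theta(x_l;p)$. For nonzero complex $a,b,q$ (generic) and complex $k,z$ define $w_{a,b;q,p}(k)=\frac{\theta(aq^{2k+1},bq^{k},aq^{k-2}/b;p)}{\theta(aq^{2k-1},bq^{k+2},aq^{k}/b;p)}\,q$, $W_{a,b;q,p}(k)=\frac{\theta(aq^{1+2k},bq,bq^2,aq^{-1}/b,a/b;p)}{\theta(aq,bq^{k+1},bq^{k+2},aq^{k-1}/b,aq^{k}/b;p)}\,q^k$, and $[z]_{a,b;q,p}=\frac{\theta(q^z,aq^z,bq^2,a/b;p)}{\theta(q,aq,bq^{z+1},aq^{z-1}/b;p)}$; subscripts like $W_{aq^{2s},bq^s;q,p}$ mean $(a,b)$ replaced by $(aq^{2s},bq^s)$. Cells $(i,j)$: column $i$, row $j$. Skyline board: $B(c_1,\dots,c_n)=\{(i,j):1\le i\le n,1\le j\le c_i\}$ for nonnegative integers $c_i$. $\mathcal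 F_k(B)$: file placements of $k$ rooks (no two in the same column; rows may repeat). Each rook cancels the cells below it in its column; $U_B(Q)$: cells neither cancelled nor occupied. Elliptic file number: $f_k(a,b;q,p;B)=\sum_{Q\in\mathcal F_k(B)}\prod_{(i,j)\in U_B(Q)}w_{a,b;q,p}(1-j)$. *)

(* Defs.v *)
From HB Require Import structures.
From mathcomp Require Import all_boot all_order all_algebra.
From mathcomp Require Import finmap.
From mathcomp Require Import complex.
From mathcomp Require Import all_classical all_reals all_analysis.

Set Implicit Arguments.
Unset Strict Implicit.
Unset Printing Implicit Defensive.

Import Order.TTheory GRing.Theory Num.Theory.
Import numFieldNormedType.Exports.

Local Open Scope fset_scope.
Local Open Scope ring_scope.
Local Open Scope complex_scope.

(* R[i] carries the topology of its norm `|z|; 0 ^+ 0 = 1, so p = 0 gives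
   theta x 0 = 1 - x. *)
Definition theta (R : realType) (x p : R[i]) : R[i] :=
  limn (fun n : nat =>
    \prod_(0 <= j < n) ((1 - p ^+ j * x) * (1 - p ^+ j.+1 / x))
      : (R[i] : numFieldType)).

(* theta(x_1, ..., x_m; p) *)
Definition thetas (R : realType) (s : seq R[i]) (p : R[i]) : R[i] :=
  \prod_(x <- s) theta x p.

(* Exponents range over int: integer powers do not depend on a choice of
   log q, and rook and file numbers only involve integer arguments. *)

Definition w_num (R : realType) (a b q p : R[i]) (k : int) : R[i] :=
  thetas [:: a * q ^ (2 * k + 1); b * q ^ k; a * q ^ (k - 2) / b] p.

Definition w_den (R : realType) (a b q p : R[i]) (k : int) : R[i] :=
  thetas [:: a * q ^ (2 * k - 1); b * q ^ (k + 2); a * q ^ k / b] p.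

Definition small_weight (R : realType) (a b q p : R[i]) (k : int) : R[i] :=
  w_num a b q p k / w_den a b q p k * q.

Definition big_weight (R : realType) (a b q p : R[i]) (k : int) : R[i] :=
  thetas [:: a * q ^ (1 + 2 * k); b * q; b * q ^ 2; a * q ^ (-1) / b; a / b] p
  / thetas [:: a * q; b * q ^ (k + 1); b * q ^ (k + 2);
               a * q ^ (k - 1) / b; a * q ^ k / b] p
  * q ^ k.

Definition elliptic_number (R : realType) (a b q p : R[i]) (z : int) : R[i] :=
  thetas [:: q ^ z; a * q ^ z; b * q ^ 2; a / b] p
  / thetas [:: q; a * q; b * q ^ (z + 1); a * q ^ (z - 1) / b] p.

(* Every denominator of W_{aq^{-2m},bq^{-m};q,p}(m) and
   [m]_{aq^{-2m},bq^{-m};q,p} is a product of theta(q;p) and of theta factors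
   occurring in some w_den a b q p k, so this makes all of them nonzero. *)
Definition generic (R : realType) (a b q p : R[i]) : Prop :=
  theta q p != 0 /\ forall k : int, w_den a b q p k != 0.

(* The cell in column i and row j is the pair (i, j); both are numbered from 1,
   rows from bottom to top. *)
Definition skyline (c : seq nat) : {fset nat * nat} :=
  [fset x | x in [seq (i, j) | i <- iota 1 (size c),
                               j <- iota 1 (nth 0%N c i.-1)]].

Definition file_placements (k : int) (B : {fset nat * nat}) :
    {fset {fset nat * nat}} :=
  [fset Q in fpowerset B |
    ((#|` Q|)%:Z == k) &&
    [forall x : Q, forall y : Q, ((val x).1 == (val y).1) ==> (x == y)]].

Definition uncancelled (B Q : {fset nat * nat}) : {fset nat * nat} :=
  [fset x in B |
    (x \notin Q) &&
    ~~ [exists y : Q, ((val y).1 == x.1) && (x.2 < (val y).2)%N]].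

Definition file_number (R : realType) (k : int) (a b q p : R[i])
    (B : {fset nat * nat}) : R[i] :=
  \sum_(Q <- file_placements k B)
    \prod_(x <- uncancelled B Q) small_weight a b q p (1 - x.2%:Z).

(* Main.v *)
Require Import Defs.
From HB Require Import structures.
From mathcomp Require Import all_boot all_order all_algebra.
From mathcomp Require Import finmap.
From mathcomp Require Import complex.
From mathcomp Require Import all_classical all_reals all_analysis.
From mathcomp Require Import ring lra zify.

Set Implicit Arguments.
Unset Strict Implicit.
Unset Printing Implicit Defensive.

Import Order.TTheory GRing.Theory Num.Theory.
Import numFieldNormedType.Exports.
Import ComplexField.Normc.

Local Open Scope classical_set_scope.
Local Open Scope fset_scope.
Local Open Scope ring_scope.
Local Open Scope complex_scope.

(* Splitting the placements on B ∪ m according to the last column gives the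
   recursion with coefficients \prod_(1 <= j <= m) w(1 - j), when that column has
   no rook, and \sum_r \prod_(r < j <= m) w(1 - j), when its rook is in row r.
   The product telescopes to W; the sum is [m] by induction on m, the step being
   an instance of the Weierstrass addition formula for theta.

   For that formula: the finite form of Jacobi's triple product identity and
   Tannery's theorem give theta(x) = v * \sum_k (-1)^k p^(k(k-1)/2) x^k with
   v != 0.  Multiplying the series of theta(xy) and theta(x/y) and summing along
   m + k and m - k, one class per common parity, shows that y theta(xy) theta(x/y)
   is a limit of 2 x 2 determinants e(x) o(y) - o(x) e(y), so the addition formula
   is a Pluecker relation. *)

(** * Convergence in R[i] *)

Local Notation cfield R := (R[i] : numFieldType).

Lemma normrcE (R : realType) (z : R[i]) : `|z| = (normc z)%:C.
Proof. by rewrite normc_def; case: z. Qed.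

Lemma normc_ge0 (R : realType) (z : R[i]) : 0 <= normc z.
Proof. by rewrite -ler0c -normrcE. Qed.

Lemma normcX (R : realType) (z : R[i]) n : normc (z ^+ n) = normc z ^+ n.
Proof.
elim: n => [|n IHn]; first by rewrite !expr0 [normc _]normc1.
by rewrite !exprS normcM IHn.
Qed.

Lemma normc_exprz (R : realType) (z : R[i]) (k : int) : normc (z ^ k) = normc z ^ k.
Proof. by case: k => n; rewrite ?NegzE -?exprnN ?normcV normcX. Qed.

Lemma normc_sum (R : realType) (I : Type) (s : seq I) (P : pred I) (f : I -> R[i]) :
  normc (\sum_(i <- s | P i) f i) <= \sum_(i <- s | P i) normc (f i).
Proof.
elim/big_rec2: _ => [|i y x _ IH]; first by rewrite [normc _]normc0.
by apply: le_trans (le_normcD _ _) _; rewrite lerD2l.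
Qed.

Lemma normc_ge_abs (R : realType) (z : R[i]) :
  `|complex.Re z| <= normc z /\ `|complex.Im z| <= normc z.
Proof.
case: z => a b /=; split; rewrite -sqrtr_sqr ler_wsqrtr //.
  by rewrite lerDl sqr_ge0.
by rewrite lerDr sqr_ge0.
Qed.

Lemma normc_le_abs (R : realType) (z : R[i]) :
  normc z <= `|complex.Re z| + `|complex.Im z|.
Proof.
have nR (a : R) : normc a%:C = `|a| by rewrite /normc /= expr0n addr0 sqrtr_sqr.
have nI : normc ('i : R[i]) = 1 by rewrite /normc /= expr0n add0r expr1n sqrtr1.
by rewrite [z in normc z]complexE (le_trans (le_normcD _ _)) // normcM nI mul1r !nR.
Qed.

(** The topology is that of the [numFieldType] structure, the one in which the limit defining
    [theta] is taken. *)
Definition cvgc (R : realType) (u : nat -> R[i]) (l : R[i]) : Prop :=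
  (u : nat -> cfield R) @ \oo --> (l : cfield R).

Lemma cvgc_cst (R : realType) (l : R[i]) : cvgc (fun _ => l) l.
Proof. exact: (cvg_cst (l : cfield R)). Qed.

Arguments cvgc_cst {R} l.

Lemma cvg_seqD (K : numFieldType) (u v : nat -> K) (a b : K) :
  u @ \oo --> a -> v @ \oo --> b -> (fun n => u n + v n) @ \oo --> a + b.
Proof. exact: cvgD. Qed.

Lemma cvgcD (R : realType) (u v : nat -> R[i]) (a b : R[i]) :
  cvgc u a -> cvgc v b -> cvgc (fun n => u n + v n) (a + b).
Proof. exact: (@cvg_seqD (cfield R) u v a b). Qed.
Arguments cvgcD {R u v a b} _ _.

Lemma cvg_seqM (K : numFieldType) (u v : nat -> K) (a b : K) :
  u @ \oo --> a -> v @ \oo --> b -> (fun n => u n * v n) @ \oo --> a * b.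
Proof. exact: cvgM. Qed.

Lemma cvgcM (R : realType) (u v : nat -> R[i]) (a b : R[i]) :
  cvgc u a -> cvgc v b -> cvgc (fun n => u n * v n) (a * b).
Proof. exact: (@cvg_seqM (cfield R) u v a b). Qed.
Arguments cvgcM {R u v a b} _ _.

Lemma cvgc_lim (R : realType) (u : nat -> R[i]) (l : R[i]) :
  cvgc u l -> limn (u : nat -> cfield R) = l.
Proof. by move=> ul; apply: (cvg_lim (@norm_hausdorff (cfield R) _) ul). Qed.

(** Moves complex limits to the real line, where squeezing and comparison of series are
    available. *)
Lemma cvg_normcP (R : realType) (u : nat -> R[i]) (l : R[i]) :
  cvgc u l <->
  ((fun n => normc (u n - l)) @ \oo --> (0 : R)).
Proof.
rewrite /cvgc; split=> [/cvgrPdist_lt ul | /cvgrPdist_lt ul]; apply/cvgrPdist_lt => e e0.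
- have e0' : 0 < e%:C by rewrite ltcR.
  near=> n.
  have : `|l - u n| < e%:C by near: n; exact: ul.
  by rewrite sub0r normrN distrC normrcE ltcR ger0_norm // normc_ge0.
(* A tolerance [e] in [R[i]] with 0 < e is real, so it can be replaced by its real part. *)
- have eE : e = (complex.Re e)%:C by rewrite RRe_real // gtr0_real.
  have e0' : 0 < complex.Re e by rewrite -ltcR -eE.
  near=> n.
  have : `|0 - normc (u n - l)| < complex.Re e by near: n; exact: ul.
  by rewrite sub0r normrN distrC normrcE eE ltcR ger0_norm // normc_ge0.
Unshelve. all: by end_near. Qed.

Lemma cvgc_squeeze (R : realType) (u : nat -> R[i]) (l : R[i]) (e : nat -> R) :
  (forall n, normc (u n - l) <= e n) -> e @ \oo --> (0 : R) ->
  cvgc u l.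
Proof.
move=> ue e0; apply/cvg_normcP; apply: (squeeze_cvgr _ (cvg_cst 0) e0).
by near=> n; rewrite normc_ge0 ue.
Unshelve. all: by end_near. Qed.

(** The real and imaginary parts are dominated by the modulus, so both real series converge
    absolutely; the complex error is at most the sum of the two real errors. *)
Lemma cvg_complex_series (R : realType) (u : nat -> R[i]) :
  cvgn (series (fun n => normc (u n))) ->
  exists l : R[i], cvgc (series u) l.
Proof.
move=> cu.
have key (f : R[i] -> R) : (forall z, `|f z| <= normc z) -> cvgn (series (f \o u)).
  move=> fz; apply: normed_cvg; apply: series_le_cvg cu => n //=.
  exact: normc_ge0.
have cre := key (@complex.Re R) (fun z => (normc_ge_abs z).1).
have cim := key (@complex.Im R) (fun z => (normc_ge_abs z).2).
exists (limn (series (@complex.Re R \o u)) +i* limn (series (@complex.Im R \o u))).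
apply: (@cvgc_squeeze _ _ _ (fun n =>
    `|limn (series (@complex.Re R \o u)) - series (@complex.Re R \o u) n|
  + `|limn (series (@complex.Im R \o u)) - series (@complex.Im R \o u) n|)).
  move=> n; apply: le_trans (normc_le_abs _) _.
  have -> : series u n = series (@complex.Re R \o u) n +i* series (@complex.Im R \o u) n.
    rewrite /series /=; elim: n => [|n IHn]; first by rewrite !big_nil.
    by rewrite !big_nat_recr //= IHn; case: (u n).
  by rewrite /= distrC lerD // distrC.
have dist_lim (v : nat -> R) : cvgn v -> (fun n => `|limn v - v n|) @ \oo --> (0 : R).
  move=> cv; rewrite -(normr0 R) -(subrr (limn v)); apply: cvg_norm.
  by apply: cvgB => //; exact: cvg_cst.
by rewrite -[0]addr0; apply: cvgD; exact: dist_lim.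
Qed.

(** * Finite triple product *)

(** The triangular number k(k-1)/2, kept in [nat] so that it serves as an exponent of p even when p
    = 0. *)
Definition tri (k : int) : nat :=
  match k with Posz n => 'C(n, 2) | Negz n => 'C(n.+2, 2) end.

Lemma triE (k : int) : ((tri k)%:Z * 2 = k * (k - 1))%R.
Proof.
have bin2Z (n : nat) : (('C(n, 2))%:Z * 2 = n%:Z * (n%:Z - 1))%R.
  elim: n => [|n IHn]; first by rewrite bin0n mul0r.
  by rewrite binS bin1 PoszD mulrDl IHn; lia.
by case: k => n; rewrite /tri bin2Z // NegzE; lia.
Qed.

(** The range is -N <= k < N, so that a bilateral series becomes an ordinary series with terms f(i)
    + f(-i-1). *)
Definition bsum (V : zmodType) (N : nat) (f : int -> V) : V :=
  \sum_(0 <= i < N) (f (Posz i) + f (Negz i)).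

(** Moving the range -N, ..., N-1 up by one lets N in and drops -N. *)
Lemma bsum_shift (V : zmodType) (N : nat) (f : int -> V) :
  bsum N (fun k => f (k + 1)) = bsum N f + f N%:Z - f (- N%:Z).
Proof.
rewrite /bsum; elim: N => [|N IHN]; first by rewrite !big_nil oppr0 add0r subrr.
rewrite !big_nat_recr //= IHN.
have -> : (Posz N + 1 = N.+1)%R by lia.
have -> : (Negz N + 1 = - N%:Z)%R by lia.
have -> : (- N.+1%:Z = Negz N)%R by lia.
rewrite [f N.+1%:Z + _]addrC addrA subrK.
by rewrite addrA [_ + f N.+1 - _]addrAC addrK.
Qed.

Lemma eq_bsum (V : zmodType) (N : nat) (f g : int -> V) :
  f =1 g -> bsum N f = bsum N g.
Proof. by move=> fg; apply: eq_bigr => i _; rewrite !fg. Qed.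

Lemma bsumD (V : zmodType) (N : nat) (f g : int -> V) :
  bsum N (fun k => f k + g k) = bsum N f + bsum N g.
Proof. by rewrite /bsum -big_split; apply: eq_bigr => i _; rewrite addrACA. Qed.

Lemma bsumMl (K : pzRingType) (N : nat) (f : int -> K) (c : K) :
  bsum N (fun k => c * f k) = c * bsum N f.
Proof. by rewrite /bsum mulr_sumr; apply: eq_bigr => i _; rewrite mulrDr. Qed.

(* The reciprocal of (p; p)_z, extended by 0 to negative z: this cuts the bilateral
   sum of the finite triple product down to |k| <= n. *)
Definition pochinv (K : fieldType) (p : K) (z : int) : K :=
  if z is Posz n then \prod_(0 <= i < n) (1 - p ^+ i.+1)^-1 else 0.

Lemma pochinv_rec (K : fieldType) (p : K) (n : nat) :
  (forall i, 1 - p ^+ i.+1 != 0) ->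
  pochinv p (n%:Z - 1) = pochinv p n * (1 - p ^+ n).
Proof.
move=> p1; case: n => [|n]; first by rewrite expr0 subrr mulr0.
have -> : (n.+1%:Z - 1 = n%:Z)%R by lia.
by rewrite /= big_nat_recr //= mulfVK.
Qed.

Definition theta_coef (K : fieldType) (p : K) (k : int) : K :=
  (-1) ^ k * p ^+ tri k.

(** Since tri(k+1) = tri(k) + k, the coefficient is multiplied by -p^k. Writing k = a - b with
    naturals on both sides avoids a division by p, which may be 0. *)
Lemma theta_coefS (K : fieldType) (p : K) (k : int) (a b : nat) :
  (k + b%:Z = a%:Z)%R ->
  p ^+ b * theta_coef p (k + 1) = - (p ^+ a * theta_coef p k).
Proof.
move=> kab; rewrite /theta_coef expfzDr ?oppr_eq0 ?oner_eq0 // expr1z.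
rewrite mulrN1 !mulNr mulrN; congr (- _); rewrite !(mulrCA (p ^+ _)) -!exprD.
congr (_ * _ ^+ _); have := triE k; have := triE (k + 1); lia.
Qed.

Definition theta_prod (K : fieldType) (p x : K) (n : nat) : K :=
  \prod_(0 <= j < n) ((1 - p ^+ j * x) * (1 - p ^+ j.+1 / x)).

(** The coefficient of x^k is, up to [theta_coef p k], the Gaussian binomial of 2n over n + k. In
    the induction the new factor is 1 + p^(2n+1) - p^n x - p^(n+1)/x, and coefficients of x^k are
    compared. Any N > n will do, because the terms with |k| > n vanish. *)
Lemma finite_triple_product (K : fieldType) (p x : K) (n N : nat) :
  (forall i, 1 - p ^+ i.+1 != 0) -> x != 0 -> (n < N)%N ->
  theta_prod p x n = (\prod_(0 <= i < n.*2) (1 - p ^+ i.+1)) *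
    bsum N (fun k => pochinv p (n%:Z + k) * pochinv p (n%:Z - k)
                     * theta_coef p k * x ^ k).
Proof.
move=> p1 x0; rewrite /theta_prod; elim: n N => [|n IHn] N ltnN.
  rewrite !big_nil mul1r; case: N ltnN => // N _; rewrite /bsum big_nat_recl //.
  rewrite big1_seq => [|i _]; first by rewrite /theta_coef /= !big_nil !(mulr1, mul0r, addr0, expr0z).
  have -> : (0 - Posz i.+1 = Negz i)%R by lia.
  by rewrite add0r /= !(mulr0, mul0r) addr0.
rewrite big_nat_recr //= (IHn N) ?(ltnW ltnN) // doubleS !big_nat_recr //=.
rewrite -[LHS]mulrA -[in RHS](mulrA _ _ (1 - p ^+ n.*2.+2)) -[RHS]mulrA.
congr (_ * _); set c := fun k => pochinv p (n%:Z + k) * pochinv p (n%:Z - k).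
have out (m : nat) (k : int) : (m%:Z < `|k|)%R ->
    pochinv p (m%:Z + k) * pochinv p (m%:Z - k) = 0.
  have neg (z : int) : (z < 0)%R -> pochinv p z = 0 by case: z.
  move=> mk; have [k0|k0] := leP 0%R k.
    by rewrite (neg (m%:Z - k)%R) ?mulr0 //; lia.
  by rewrite (neg (m%:Z + k)%R) ?mul0r //; lia.
have c0 k : (n%:Z < `|k|)%R -> c k = 0 by exact: out.
(* Multiplication by x or 1/x shifts the index by one; the boundary terms of the range vanish
   because n + 1 < N. *)
have shl : bsum N (fun k => c (k - 1) * theta_coef p (k - 1) * x ^ k)
         = x * bsum N (fun k => c k * theta_coef p k * x ^ k).
  have := bsum_shift N (fun k => c (k - 1) * theta_coef p (k - 1) * x ^ k).
  rewrite (c0 (N%:Z - 1)) ?(c0 (- N%:Z - 1)); [|lia..].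
  rewrite !(mulr0,mul0r) subr0 addr0 => <-; rewrite -bsumMl; apply: eq_bsum => k.
  by rewrite addrK expfzDr // expr1z; ring.
have shr : bsum N (fun k => c (k + 1) * theta_coef p (k + 1) * x ^ k)
         = x^-1 * bsum N (fun k => c k * theta_coef p k * x ^ k).
  have := bsum_shift N (fun k => x^-1 * (c k * theta_coef p k * x ^ k)).
  rewrite (c0 N%:Z) ?(c0 (- N%:Z)); [|lia..].
  rewrite !(mulr0,mul0r) subr0 addr0 -bsumMl => <-; apply: eq_bsum => k.
  by rewrite expfzDr // expr1z; field.
transitivity (bsum N (fun k => (1 + p ^+ n.*2.+1) * (c k * theta_coef p k * x ^ k)
   + ((- p ^+ n) * (c (k - 1) * theta_coef p (k - 1) * x ^ k)
   + (- p ^+ n.+1) * (c (k + 1) * theta_coef p (k + 1) * x ^ k)))).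
  rewrite !bsumD !bsumMl shl shr /c -addnn !exprS exprD.
  by field.
rewrite -bsumMl; apply: eq_bsum => k.
transitivity (((1 + p ^+ n.*2.+1) * (c k * theta_coef p k) +
    (- p ^+ n * (c (k - 1) * theta_coef p (k - 1)) +
     - p ^+ n.+1 * (c (k + 1) * theta_coef p (k + 1)))) * x ^ k); first by ring.
rewrite [RHS]mulrA; congr (_ * _).
have [kle|kgt] := leP (`|k|)%R n.+1%:Z; last first.
  by rewrite !c0 ?(out n.+1) ?(mulr0, mul0r, addr0) //; lia.
(* For |k| <= n + 1 everything is expressed through the naturals A = n + 1 + k and B = n + 1 - k,
   with A + B = 2n + 2. *)
have [A AE] : exists A : nat, (n.+1%:Z + k = A%:Z)%R by exists (absz (n.+1%:Z + k)%R); lia.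
have [B BE] : exists B : nat, (n.+1%:Z - k = B%:Z)%R by exists (absz (n.+1%:Z - k)%R); lia.
rewrite /c AE BE.
have -> : (n%:Z + k = A%:Z - 1)%R by lia.
have -> : (n%:Z - k = B%:Z - 1)%R by lia.
have -> : (n%:Z + (k - 1) = A%:Z - 1 - 1)%R by lia.
have -> : (n%:Z - (k - 1) = B%:Z)%R by lia.
have -> : (n%:Z + (k + 1) = A%:Z)%R by lia.
have -> : (n%:Z - (k + 1) = B%:Z - 1 - 1)%R by lia.
have ep : p ^+ n.+1 * theta_coef p (k + 1) = - (p ^+ A * theta_coef p k).
  by apply: theta_coefS; lia.
have em : p ^+ n * theta_coef p (k - 1) = - (p ^+ B * theta_coef p k).
  have := @theta_coefS _ p (k - 1) n B; rewrite subrK => -> //; first by rewrite opprK.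
  by lia.
rewrite !(pochinv_rec _ p1).
have {}ep (z : K) : - p ^+ n.+1 * (z * theta_coef p (k + 1)) = p ^+ A * z * theta_coef p k.
  by rewrite mulNr mulrCA ep mulrN opprK; ring.
have {}em (z : K) : - p ^+ n * (z * theta_coef p (k - 1)) = p ^+ B * z * theta_coef p k.
  by rewrite mulNr mulrCA em mulrN opprK; ring.
rewrite ep em.
have rec2 m : pochinv p (m.+1%:Z - 1 - 1)
    = pochinv p m.+1%:Z * (1 - p ^+ m.+1) * (1 - p ^+ m).
  rewrite -pochinv_rec //; have -> : (m.+1%:Z - 1 = m%:Z)%R by lia.
  exact: pochinv_rec.
have AB : (A + B = n.*2.+2)%N by lia.
(* The extreme indices k = -(n+1) and k = n+1 are separate: there [pochinv] is taken at -2, where it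
   is 0 by convention, and [rec2] does not apply. *)
case: A AB {AE ep kle} => [AB|A AB].
  have -> : (0%:Z - 1 - 1 = Negz 1)%R by [].
  rewrite add0n in AB; rewrite AB rec2 /= !expr0 !(mul0r, mulr0, mul1r, subrr); ring.
case: B AB {BE em} => [AB|B AB].
  have -> : (0%:Z - 1 - 1 = Negz 1)%R by [].
  rewrite addn0 in AB; rewrite AB rec2 /= !expr0 !(mul0r, mulr0, mul1r, subrr); ring.
rewrite !rec2; have <- : (A + B = n.*2)%N by lia.
by rewrite !exprS exprD; ring.
Qed.

(** * Limits of series and products *)

Lemma cvgc_sum (R : realType) (f : nat -> nat -> R[i]) (g : nat -> R[i]) (N : nat) :
  (forall k, cvgc (f ^~ k) (g k)) ->
  cvgc (fun n => \sum_(0 <= k < N) f n k) (\sum_(0 <= k < N) g k).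
Proof.
move=> fg; elim: N => [|N IHN].
  rewrite big_nil; have -> : (fun n => \sum_(0 <= k < 0) f n k) = fun _ => 0.
    by apply/funext => n; rewrite big_nil.
  exact: cvgc_cst.
have sumS (h : nat -> R[i]) : \sum_(0 <= k < N.+1) h k = \sum_(0 <= k < N) h k + h N.
  by rewrite big_nat_recr.
rewrite sumS (_ : (fun n => _) = fun n => \sum_(0 <= k < N) f n k + f n N).
  exact: (cvgcD IHN (fg N)).
by apply/funext => n; exact: sumS.
Qed.

(** Dominated convergence for series. Cut at a fixed N: the head converges term by term, and the
    rest is bounded by the tail of [series M], however fast [phi] grows. *)
Lemma tannery (R : realType) (f : nat -> nat -> R[i]) (g : nat -> R[i]) (G : R[i])
    (M : nat -> R) (phi : nat -> nat) :
  (forall n, (n <= phi n)%N) ->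
  (forall n k, normc (f n k) <= M k) -> cvgn (series M) ->
  (forall k, cvgc (f ^~ k) (g k)) ->
  cvgc (series g) G ->
  cvgc (fun n => \sum_(0 <= k < phi n) f n k) G.
Proof.
move=> phin fM cM fg gG; apply/cvg_normcP/cvgrPdist_lt => e e0.
have e3 : 0 < e / 3 by rewrite divr_gt0.
have M0 k : 0 <= M k by exact: le_trans (normc_ge0 _) (fM 0%N k).
have ndM : nondecreasing_seq (series M).
  by apply/nondecreasing_seqP => n; rewrite /series /= big_nat_recr //= lerDl.
(* One N makes both the tail of the dominating series and the error of the limit series less than
   e/3; the last third goes to the head. *)
have [N [NM Ng]] : exists N, limn (series M) - series M N < e / 3
                        /\ normc (series g N - G) < e / 3.
  have /cvgrPdist_lt/(_ _ e3) hM := cM.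
  have /cvg_normcP/cvgrPdist_lt/(_ _ e3) hg := gG.
  have [N _ HN] := filterI hM hg.
  exists N; have [/= h1 h2] := HN N (leqnn N); split.
    exact: le_lt_trans (ler_norm _) h1.
  by move: h2; rewrite sub0r normrN ger0_norm // normc_ge0.
have fgN : cvgc (fun n => \sum_(0 <= k < N) f n k) (series g N).
  exact: cvgc_sum.
have /cvg_normcP/cvgrPdist_lt/(_ _ e3) hfg := fgN.
near=> n.
rewrite sub0r normrN ger0_norm ?normc_ge0 //.
have Nphi : (N <= phi n)%N by apply: leq_trans (phin n); near: n; exact: nbhs_infty_ge.
rewrite (big_cat_nat _ Nphi) //=.
have -> : \sum_(0 <= k < N) f n k + \sum_(N <= k < phi n) f n k - G =
   (\sum_(0 <= k < N) f n k - series g N) + (\sum_(N <= k < phi n) f n k + (series g N - G)) by ring.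
have h1 : normc (\sum_(0 <= k < N) f n k - series g N) < e / 3.
  have : `|0 - normc (\sum_(0 <= k < N) f n k - series g N)| < e / 3 by near: n; exact: hfg.
  by rewrite sub0r normrN ger0_norm ?normc_ge0.
have h2 : normc (\sum_(N <= k < phi n) f n k) < e / 3.
  apply: le_lt_trans NM; apply: le_trans (normc_sum _ _ _) _.
  apply: le_trans (ler_sum _ (fun k _ => fM n k)) _.
  rewrite lerBrDl [series M N]/series /= -big_cat_nat //=.
  exact: nondecreasing_cvgn_le.
have h3 := le_normcD (\sum_(0 <= k < N) f n k - series g N) (\sum_(N <= k < phi n) f n k + (series g N - G)).
have h4 := le_normcD (\sum_(N <= k < phi n) f n k) (series g N - G).
move: h1 h2 Ng h3 h4; lra.
Unshelve. all: by end_near. Qed.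

(** As 1 + t <= exp t, the partial products P_n are bounded by the exponential of the sum of all
    |a_i|. Then P_(n+1) - P_n = a_n P_n is absolutely summable. The bound is exported because it
    later serves as the domination in [tannery]. *)
Lemma cvg_complex_prod (R : realType) (a : nat -> R[i]) :
  cvgn (series (fun n => normc (a n))) ->
  exists2 l : R[i],
    cvgc (fun n => \prod_(0 <= i < n) (1 + a i)) l
    & exists B : R, forall n, normc (\prod_(0 <= i < n) (1 + a i)) <= B.
Proof.
move=> ca; set P := fun n => \prod_(0 <= i < n) (1 + a i).
have [B PB] : exists B : R, forall n, normc (P n) <= B.
  exists (expR (limn (series (fun n => normc (a n))))) => n.
  apply: (@le_trans _ _ (expR (series (fun n => normc (a n)) n))); last first.
    rewrite ler_expR; apply: nondecreasing_cvgn_le => //.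
    apply/nondecreasing_seqP => k; rewrite /series /= big_nat_recr //= lerDl.
    exact: normc_ge0.
  rewrite /P /series /=; elim: n => [|n IHn].
    by rewrite !big_nil expR0 [normc _]normc1.
  rewrite !big_nat_recr //= normcM expRD ler_pM ?normc_ge0 //.
  apply: le_trans (expR_ge1Dx _); apply: le_trans (le_normcD _ _) _.
  by rewrite [normc 1]normc1.
have [l hl] : exists l : R[i],
    cvgc (series (fun n => a n * P n)) l.
  apply: cvg_complex_series; apply: (@series_le_cvg _ _ (fun n => B * normc (a n))).
  - by move=> n; exact: normc_ge0.
  - by move=> n; rewrite mulr_ge0 ?normc_ge0 // (le_trans (normc_ge0 _) (PB 0%N)).
  - by move=> n; rewrite normcM mulrC ler_wpM2r ?normc_ge0.
  - exact: is_cvg_seriesZ.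
exists (1 + l); last by exists B.
have -> : P = (fun n => 1 + series (fun n => a n * P n) n).
  apply/funext => n; rewrite /series /=; elim: n => [|n IHn].
    by rewrite /P !big_nil addr0.
  by rewrite big_nat_recr //= addrA -IHn {1}/P big_nat_recr //= -/(P n); ring.
exact: (cvgcD (cvgc_cst 1) hl).
Qed.

(** The ratio r^n X of consecutive terms is eventually at most 1/2, which gives a comparison with a
    geometric series of ratio 1/2. *)
Lemma is_cvg_series_gauss (R : realType) (r X : R) : 0 <= r < 1 -> 0 <= X ->
  cvgn (series (fun n => r ^+ 'C(n, 2) * X ^+ n)).
Proof.
move=> /andP[r0 r1] X0.
have [m rm] : exists m, forall n, (m <= n)%N -> 2 * (r ^+ n * X) <= 1.
  have : (fun n => 2 * (r ^+ n * X)) @ \oo --> (2 * (0 * X) : R).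
    apply: cvgM; first exact: cvg_cst.
    by apply: cvgM; [apply: cvg_expr; rewrite ger0_norm | exact: cvg_cst].
  rewrite mul0r mulr0 => /cvgrPdist_lt/(_ _ ltr01)[m _ hm]; exists m => n mn.
  have := hm n mn; rewrite /= sub0r normrN => h; exact: ltW (le_lt_trans (ler_norm _) h).
(* The terms rescaled by 2^n: from rank m on they do not increase, so they are all bounded by the
   sum of the first m + 1 of them. *)
set b := fun n => 2 ^+ n * (r ^+ 'C(n, 2) * X ^+ n).
have b0 n : 0 <= b n by rewrite !mulr_ge0 ?exprn_ge0.
have bS n : b n.+1 = b n * (2 * (r ^+ n * X)).
  by rewrite /b !exprS binS bin1 exprD; ring.
have bB n : b n <= \sum_(0 <= j < m.+1) b j.
  elim: n => [|n IHn].
    by rewrite big_nat_recl //= lerDl sumr_ge0.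
  have [nm|mn] := ltnP n m.
    rewrite (big_cat_nat _ (n := n.+1)) //= ?ltnS 1?ltnW //.
    by rewrite [X in _ + X]big_ltn //= addrCA lerDl addr_ge0 ?sumr_ge0.
  by apply: le_trans IHn; rewrite bS ler_piMr // rm.
apply: (@series_le_cvg _ _ (geometric (\sum_(0 <= j < m.+1) b j) 2^-1)).
- by move=> n; rewrite mulr_ge0 ?exprn_ge0.
- by move=> n; rewrite /= mulr_ge0 ?exprn_ge0 ?sumr_ge0 ?invr_ge0.
- by move=> n; rewrite /= exprVn ler_pdivlMr ?exprn_gt0 // mulrC bB.
- by apply: is_cvg_geometric_series; rewrite ger0_norm ?invr_ge0 // invf_lt1 ?ltr1n.
Qed.

Definition theta_term (R : realType) (p x : R[i]) (k : int) : R[i] :=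
  theta_coef p k * x ^ k.

(** The two halves of the bilateral series are Gaussian series, in |x| for k >= 0 and in 1/|x| for k
    < 0. *)
Lemma is_cvg_theta_term (R : realType) (p x : R[i]) : normc p < 1 ->
  cvgn (series (fun i => normc (theta_term p x (Posz i)) + normc (theta_term p x (Negz i)))).
Proof.
move=> p1; set r := normc p; set X := normc x.
have r0 : 0 <= r by exact: normc_ge0.
have X0 : 0 <= X by exact: normc_ge0.
have nt k : normc (theta_term p x k) = r ^+ tri k * X ^ k.
  rewrite !normcM !normc_exprz normcN [normc 1]normc1 exp1rz mul1r.
  by rewrite normcX.
have rX Y : 0 <= Y -> cvgn (series (fun n => r ^+ 'C(n, 2) * Y ^+ n)).
  by move=> Y0; apply: is_cvg_series_gauss => //; rewrite r0.
apply: (is_cvg_seriesD (f := fun i => normc (theta_term p x (Posz i)))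
                       (g := fun i => normc (theta_term p x (Negz i)))).
  by rewrite (_ : (fun i => _) = (fun n => r ^+ 'C(n, 2) * X ^+ n)); [exact: rX | rewrite funeqE => n; rewrite nt].
apply: (@series_le_cvg _ _ (fun n => X^-1 * (r ^+ 'C(n, 2) * X^-1 ^+ n))).
- by move=> n; exact: normc_ge0.
- by move=> n; rewrite !mulr_ge0 ?exprn_ge0 ?invr_ge0.
- move=> n; rewrite nt NegzE -exprnN -exprVn exprS mulrCA.
  rewrite ler_wpM2l ?invr_ge0 // ler_wpM2r ?exprn_ge0 ?invr_ge0 //.
  (* As r <= 1, the exponent C(n+2, 2) may be lowered to C(n, 2). *)
  apply: ler_wiXn2l; [done|exact: ltW|].
  by rewrite -NegzE /tri !binS; lia.
- by apply: is_cvg_seriesZ; apply: rX; rewrite invr_ge0.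
Qed.

Lemma sub1X_neq0 (R : realType) (p : R[i]) (i : nat) :
  normc p < 1 -> 1 - p ^+ i.+1 != 0.
Proof.
move=> p1; rewrite subr_eq0; apply/eqP => /(congr1 (@normc R)).
rewrite [normc 1]normc1 normcX => /esym/eqP; rewrite pexpr_eq1 ?normc_ge0 //.
by rewrite lt_eqF.
Qed.

(** Here u = (p;p)_oo. Its reciprocal v is built as a convergent product of its own, with factors
    1/(1 - p^(i+1)) = 1 + p^(i+1)/(1 - p^(i+1)), so that u v = 1 comes from the partial products and
    shows that neither is 0. *)
Lemma cvgc_pochinv (R : realType) (p : R[i]) : normc p < 1 ->
  exists u v : R[i], [/\ u * v = 1,
    cvgc (fun n => \prod_(0 <= i < n) (1 - p ^+ i.+1)) u,
    cvgc (fun n => pochinv p n%:Z) v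
  & exists M : R, forall z, normc (pochinv p z) <= M].
Proof.
move=> p1; set r := normc p.
have r0 : 0 <= r by exact: normc_ge0.
have geo c : cvgn (series (fun n => c * r ^+ n.+1)).
  rewrite (_ : (fun n => _) = geometric (c * r) r); last first.
    by rewrite funeqE => n /=; rewrite exprS mulrA.
  by apply: is_cvg_geometric_series; rewrite ger0_norm.
have [u hu _] : exists2 u : R[i], cvgc (fun n => \prod_(0 <= i < n) (1 + (- p ^+ i.+1))) u
    & exists B : R, forall n, normc (\prod_(0 <= i < n) (1 + (- p ^+ i.+1))) <= B.
  apply: cvg_complex_prod.
  rewrite (_ : (fun n => _) = (fun n => 1 * r ^+ n.+1)); first exact: geo.
  by rewrite funeqE => n; rewrite normcN normcX mul1r.
have [v hv [M hM]] : exists2 v : R[i],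
      cvgc (fun n => \prod_(0 <= i < n) (1 + p ^+ i.+1 / (1 - p ^+ i.+1))) v
    & exists B : R, forall n, normc (\prod_(0 <= i < n) (1 + p ^+ i.+1 / (1 - p ^+ i.+1))) <= B.
  apply: cvg_complex_prod.
  apply: (@series_le_cvg _ _ (fun n => (1 - r)^-1 * r ^+ n.+1)).
  - by move=> n; exact: normc_ge0.
  - by move=> n; rewrite mulr_ge0 ?exprn_ge0 // invr_ge0 subr_ge0 ltW.
  - move=> n; rewrite normcM normcV normcX mulrC ler_wpM2r ?exprn_ge0 //.
    have rn : r ^+ n.+1 <= r by rewrite exprS ler_piMr // exprn_ile1 // ltW.
    have := le_normcD (1 - p ^+ n.+1) (p ^+ n.+1).
    rewrite subrK [normc 1]normc1 normcX -/r => h.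
    rewrite lef_pV2 ?posrE ?subr_gt0 //; move: p1 rn h; rewrite -/r; lra.
  - exact: geo.
have vE n : pochinv p n%:Z = \prod_(0 <= i < n) (1 + p ^+ i.+1 / (1 - p ^+ i.+1)).
  by apply: eq_bigr => i _; field; exact: sub1X_neq0.
exists u, v; split.
- have h1 : (fun n => \prod_(0 <= i < n) (1 + (- p ^+ i.+1)) *
      \prod_(0 <= i < n) (1 + p ^+ i.+1 / (1 - p ^+ i.+1))) = fun _ => 1.
    apply/funext => n; rewrite -big_split big1 //= => i _.
    by field; exact: sub1X_neq0.
  by rewrite -(cvgc_lim (cvgcM hu hv)) h1 (cvgc_lim (cvgc_cst 1)).
- exact: hu.
- by rewrite (_ : (fun n => _) = fun n => \prod_(0 <= i < n) (1 + p ^+ i.+1 / (1 - p ^+ i.+1))) // funeqE.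
- exists M => -[n|n]; first by rewrite vE.
  by rewrite [normc _]normc0 (le_trans (normc_ge0 _) (hM 0%N)).
Qed.

Lemma cvgc_shift_int (R : realType) (f : int -> R[i]) (l : R[i]) (k : int) :
  cvgc (fun n => f n%:Z) l -> cvgc (fun n => f (n%:Z + k)) l.
Proof.
move=> /cvg_normcP/cvgrPdist_lt fl; apply/cvg_normcP/cvgrPdist_lt => e e0.
have [N _ hN] := fl e e0.
exists (N + absz k)%N => // n /= Nn.
have [m mE] : exists m : nat, (n%:Z + k = m%:Z)%R by exists (absz (n%:Z + k)%R); lia.
by rewrite mE; apply: (hN m) => /=; lia.
Qed.

(** Let n grow in the finite triple product: the prefactor tends to u, each coefficient to v^2 times
    [theta_coef p k], and u v^2 = v. The constant v = 1/(p;p)_oo is chosen before x, which the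
    homogeneous relations below rely on. *)
Lemma cvgc_theta (R : realType) (p : R[i]) : normc p < 1 ->
  exists2 v : R[i], v != 0 & forall x, x != 0 ->
    cvgc (theta_prod p x) (theta x p) /\
    exists2 T : R[i], cvgc (fun N => bsum N (theta_term p x)) T & theta x p = v * T.
Proof.
move=> p1; have [u [v [uv hu hv [M hM]]]] := cvgc_pochinv p1.
exists v; first by apply/eqP => v0; move/eqP: uv; rewrite v0 mulr0 eq_sym oner_eq0.
move=> x x0; set al := theta_term p x.
have sal := is_cvg_theta_term (x := x) p1.
have [T hT] : exists T, cvgc (series (fun i => al (Posz i) + al (Negz i))) T.
  apply: cvg_complex_series; apply: series_le_cvg sal => n; rewrite ?addr_ge0 ?normc_ge0 //.
  exact: le_normcD.
have M0 : 0 <= M by exact: le_trans (normc_ge0 _) (hM 0).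
pose c n k := pochinv p (n%:Z + k) * pochinv p (n%:Z - k).
have hc k : cvgc (c ^~ k) (v * v).
  by apply: cvgcM; apply: cvgc_shift_int.
have hS : cvgc (fun n => \sum_(0 <= i < n.+1)
    (c n (Posz i) * al (Posz i) + c n (Negz i) * al (Negz i))) (v * v * T).
  refine (@tannery _ (fun n i => c n (Posz i) * al (Posz i) + c n (Negz i) * al (Negz i))
    (fun i => v * v * (al (Posz i) + al (Negz i))) _
    (fun i => M * M * (normc (al (Posz i)) + normc (al (Negz i)))) S _ _ _ _ _).
  - by move=> n; exact: leqnSn.
  - move=> n k; apply: le_trans (le_normcD _ _) _; rewrite mulrDr.
    by rewrite lerD // normcM ler_wpM2r ?normc_ge0 // normcM ler_pM ?normc_ge0.
  - exact: is_cvg_seriesZ.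
  - by move=> k; rewrite mulrDr; apply: cvgcD; apply: (cvgcM (hc _) (cvgc_cst _)).
  - rewrite (_ : series _ = fun n => v * v * series (fun i => al (Posz i) + al (Negz i)) n).
      exact: (cvgcM (cvgc_cst _) hT).
    by apply/funext => n; rewrite /series /= mulr_sumr.
have hth : cvgc (theta_prod p x) (v * T).
  have -> : v * T = u * (v * v * T) by rewrite !mulrA uv mul1r.
  rewrite (_ : theta_prod p x = fun n => (\prod_(0 <= i < n.*2) (1 - p ^+ i.+1)) *
    \sum_(0 <= i < n.+1) (c n (Posz i) * al (Posz i) + c n (Negz i) * al (Negz i))); last first.
    apply/funext => n; rewrite (@finite_triple_product _ p x n n.+1) //; last first.
      by move=> i; exact: sub1X_neq0.
    by congr (_ * _); apply: eq_bigr => i _; rewrite /c /al /theta_term !mulrA.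
  apply: (cvgcM _ hS).
  (* The prefactor has 2n factors, hence is a subsequence of the products tending to u. *)
  move/cvg_normcP/cvgrPdist_lt: hu => hu; apply/cvg_normcP/cvgrPdist_lt => e e0.
  have [N _ hN] := hu e e0; exists N => // n /= Nn; apply: (hN n.*2) => /=.
  by rewrite -addnn (leq_trans Nn) ?leq_addr.
have thE : theta x p = v * T by exact: cvgc_lim hth.
split; first (rewrite thE; exact: hth).
by exists T; [exact: hT | exact: thE].
Qed.

(** * Weierstrass addition formula *)

(** The index range of [bsum] as a list, so that double sums can be reindexed as sums over lists of
    pairs. *)
Definition window (N : nat) : seq int :=
  [seq Posz i | i <- iota 0 N] ++ [seq Negz i | i <- iota 0 N].

Lemma mem_window (N : nat) (k : int) :
  (k \in window N) = (- N%:Z <= k) && (k < N%:Z).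
Proof.
rewrite mem_cat; apply/orP/andP => [[]|[]].
- by case/mapP => i; rewrite mem_iota => iN ->; lia.
- by case/mapP => i; rewrite mem_iota => iN ->; lia.
case: k => k k1 k2; [left|right]; rewrite map_f ?mem_iota //; lia.
Qed.

Lemma uniq_window (N : nat) : uniq (window N).
Proof.
rewrite cat_uniq !map_inj_uniq ?iota_uniq /= ?andbT; try by move=> i j [].
by apply/hasPn => k /mapP[i _ ->]; apply/mapP => -[].
Qed.

Lemma sum_window (V : zmodType) (N : nat) (f : int -> V) :
  \sum_(k <- window N) f k = bsum N f.
Proof. by rewrite big_cat !big_map /bsum big_split /= /index_iota subn0. Qed.

Lemma sum_uniq_sub (V : zmodType) (I : eqType) (s t : seq I) (f : I -> V) :
  uniq s -> uniq t -> {subset s <= t} ->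
  \sum_(z <- t) f z = \sum_(z <- s) f z + \sum_(z <- t | z \notin s) f z.
Proof.
move=> us ut st; rewrite (bigID (mem s)) /=; congr (_ + _).
rewrite -big_filter; apply: perm_big; apply: uniq_perm => // [|z].
  exact: filter_uniq.
by rewrite mem_filter andb_idr //; exact: st.
Qed.

Definition square_window (N : nat) : seq (int * int) :=
  [seq (m, k) | m <- window N, k <- window N].

Lemma mem_square_window (N : nat) (z : int * int) :
  (z \in square_window N) = (z.1 \in window N) && (z.2 \in window N).
Proof.
case: z => m k; apply/allpairsP/andP => /= [[[i j] /= [i1 j1 [-> ->]]]//|[m1 k1]].
by exists (m, k).
Qed.

Lemma uniq_square_window (N : nat) : uniq (square_window N).
Proof. by apply: allpairs_uniq; rewrite ?uniq_window // => -[? ?] [? ?]. Qed.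

Lemma sum_square_window (K : pzRingType) (N : nat) (f g : int -> K) :
  \sum_(z <- square_window N) f z.1 * g z.2 = bsum N f * bsum N g.
Proof.
rewrite big_allpairs -!sum_window big_distrlr /=; apply: eq_bigr => i _.
by [].
Qed.

(** An absolutely convergent double series may be summed along any lists squeezed between growing
    squares: what lies outside the inner square is at most a(phi n) b(phi n) - a(n) b(n), and both
    products tend to the same limit. *)
Lemma cvgc_sandwich (R : realType) (f g : int -> R[i]) (F G : R[i])
    (A : nat -> seq (int * int)) (phi : nat -> nat) :
  cvgn (fun n => bsum n (fun k => normc (f k))) -> cvgn (fun n => bsum n (fun k => normc (g k))) ->
  cvgc (fun n => bsum n f) F -> cvgc (fun n => bsum n g) G ->
  (forall n, (n <= phi n)%N) ->
  (forall n, uniq (A n)) -> (forall n, {subset square_window n <= A n}) ->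
  (forall n, {subset A n <= square_window (phi n)}) ->
  cvgc (fun n => \sum_(z <- A n) f z.1 * g z.2) (F * G).
Proof.
move=> cf cg hf hg hphi uA sA As.
set a := fun n => bsum n (fun k => normc (f k)).
set b := fun n => bsum n (fun k => normc (g k)).
have cab : (fun n => a n * b n) @ \oo --> limn a * limn b by exact: cvgM.
have cphi : (fun n => a (phi n) * b (phi n)) @ \oo --> limn a * limn b.
  apply/cvgrPdist_lt => e e0; have /cvgrPdist_lt/(_ e e0)[N _ hN] := cab.
  by exists N => // n /= Nn; apply: (hN (phi n)); exact: leq_trans (hphi n).
have d0 : cvgc (fun n => \sum_(z <- A n | z \notin square_window n) f z.1 * g z.2) 0.
  apply: (@cvgc_squeeze _ _ _ (fun n => a (phi n) * b (phi n) - a n * b n)); last first.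
    by rewrite -(subrr (limn a * limn b)); exact: cvgB.
  move=> n; rewrite subr0; apply: le_trans (normc_sum _ _ _) _.
  rewrite lerBrDl.
  have -> : a n * b n = \sum_(z <- square_window n) normc (f z.1 * g z.2).
    by rewrite -sum_square_window; apply: eq_bigr => z _; rewrite normcM.
  have -> : a (phi n) * b (phi n) = \sum_(z <- square_window (phi n)) normc (f z.1 * g z.2).
    by rewrite -sum_square_window; apply: eq_bigr => z _; rewrite normcM.
  rewrite -sum_uniq_sub ?uniq_square_window //.
  rewrite (sum_uniq_sub _ (uA n) (uniq_square_window _) (As n)) lerDl.
  by apply: sumr_ge0 => z _; exact: normc_ge0.
rewrite (_ : (fun n => _) = fun n => bsum n f * bsum n g
    + \sum_(z <- A n | z \notin square_window n) f z.1 * g z.2).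
  by rewrite -[F * G]addr0; exact: (cvgcD (cvgcM hf hg) d0).
apply/funext => n; rewrite -sum_square_window -sum_uniq_sub //.
exact: uniq_square_window.
Qed.

(* Pairs (m, k) whose sum and difference are (2i + 2, 2j) or (2i + 1, 2j + 1). *)
Definition rotated_window (N : nat) : seq (int * int) :=
  [seq (i + j + 1, i - j + 1) | i <- window N.+1, j <- window N.+1] ++
  [seq (i + j + 1, i - j) | i <- window N.+1, j <- window N.+1].

Lemma uniq_rotated_window (N : nat) : uniq (rotated_window N).
Proof.
rewrite cat_uniq; apply/and3P; split.
- apply: allpairs_uniq; [exact: uniq_window..|].
  by move=> [i j] [i' j'] _ _ /= [h1 h2]; congr (_, _); lia.
(* The two families are disjoint by the parity of the sum of the coordinates. *)
- apply/hasPn => z z2; apply/negP => z1.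
  have /allpairsP[[i j] /= [_ _ zij]] : z \in _ := z1.
  have /allpairsP[[i' j'] /= [_ _ zij']] : z \in _ := z2.
  by move: zij; rewrite zij' => -[h1 h2]; lia.
- apply: allpairs_uniq; [exact: uniq_window..|].
  by move=> [i j] [i' j'] _ _ /= [h1 h2]; congr (_, _); lia.
Qed.

(** The parity of m + k selects the family. The corner m = k = -N forces i = -N - 1, whence the side
    [N.+1] in [rotated_window]. *)
Lemma square_window_sub_rotated (N : nat) :
  {subset square_window N <= rotated_window N}.
Proof.
move=> [m k]; rewrite mem_square_window !mem_window /= => /andP[/andP[m1 m2] /andP[k1 k2]].
rewrite mem_cat; apply/orP.
have [par|par] : (exists i, m + k = 2 * i + 2) \/ (exists i, m + k = 2 * i + 1).
  have := divz_eq (m + k) 2; have := ltz_pmod (m + k) (isT : 0 < 2%:Z).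
  have := modz_ge0 (m + k) (isT : 2%:Z != 0) => h1 h2 h3.
  have [h|h] : ((m + k) %% 2)%Z = 0 \/ ((m + k) %% 2)%Z = 1 by lia.
    by left; exists (((m + k) %/ 2)%Z - 1); lia.
  by right; exists (((m + k) %/ 2)%Z); lia.
- case: par => i hi; left; apply/allpairsP; exists (i, m - i - 1) => /=.
  by rewrite !mem_window; split; [lia|lia|congr (_, _); lia].
- case: par => i hi; right; apply/allpairsP; exists (i, m - i - 1) => /=.
  by rewrite !mem_window; split; [lia|lia|congr (_, _); lia].
Qed.

(** The largest coordinate is i - j + 1 = 2N + 2, reached at i = N and j = -N - 1. *)
Lemma rotated_window_sub_square (N : nat) :
  {subset rotated_window N <= square_window (2 * N + 3)}.
Proof.
move=> z; rewrite mem_square_window !mem_window mem_cat.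
by case/orP => /allpairsP[[i j] /= []]; rewrite !mem_window => h1 h2 -> /=; lia.
Qed.

Lemma cvgc_unique (R : realType) (u v : nat -> R[i]) (a b : R[i]) :
  cvgc u a -> cvgc v b -> u =1 v -> a = b.
Proof. by move=> ua vb /funext uv; rewrite -(cvgc_lim ua) -(cvgc_lim vb) uv. Qed.
Arguments cvgc_unique {R u v a b} _ _ _.

(** Together with [odd_sum], these are truncations of the Jacobi series of theta(-x^2; p^2) and of x
    theta(-p x^2; p^2). The exponents under [absz] are nonnegative. *)
Definition even_sum (K : fieldType) (p : K) (N : nat) (x : K) : K :=
  \sum_(i <- window N.+1) p ^+ absz (i * (i + 1)) * x ^ (2 * i + 2).

Definition odd_sum (K : fieldType) (p : K) (N : nat) (x : K) : K :=
  \sum_(i <- window N.+1) p ^+ absz (i * i) * x ^ (2 * i + 1).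

(** In the rotated coordinates the terms in ij cancel from the sum of the two triangular numbers, so
    i and j separate. The sign is the parity of the index sum, 2i + 2 or 2i + 1. *)
Lemma theta_coefM (K : fieldType) (p : K) (i j : int) :
  theta_coef p (i + j + 1) * theta_coef p (i - j + 1)
    = p ^+ absz (i * (i + 1)) * p ^+ absz (j * j) /\
  theta_coef p (i + j + 1) * theta_coef p (i - j)
    = - (p ^+ absz (i * i) * p ^+ absz (j * (j + 1))).
Proof.
have N1 : (-1 : K) != 0 by rewrite oppr_eq0 oner_eq0.
have sgn2 (l : int) : (-1 : K) ^ (l + l) = 1.
  by rewrite expfzDr // -expfzMl mulrNN mulr1 exp1rz.
have eq_abs (a b c d : nat) : (a + b = c + d)%N -> p ^+ a * p ^+ b = p ^+ c * p ^+ d.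
  by rewrite -!exprD => ->.
have ge0 (l : int) : 0 <= l * (l + 1) by have [?|?] := leP 0 l; nia.
have ge0' (l : int) : 0 <= l * l by nia.
split; rewrite /theta_coef mulrACA -expfzDr //.
  have -> : i + j + 1 + (i - j + 1) = (i + 1) + (i + 1) by ring.
  rewrite sgn2 mul1r; apply: eq_abs.
  have := gez0_abs (ge0 i); have := gez0_abs (ge0' j).
  have := triE (i + j + 1); have := triE (i - j + 1); lia.
have -> : i + j + 1 + (i - j) = (i + i) + 1 by ring.
rewrite expfzDr // sgn2 expr1z mul1r mulN1r; congr (- _); apply: eq_abs.
have := gez0_abs (ge0' i); have := gez0_abs (ge0 j).
have := triE (i + j + 1); have := triE (i - j); lia.
Qed.

(** The powers of y are y^(2j) in the first family and y^(2j+1) in the second; the extra factor y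
    raises them to exactly those of [odd_sum] and [even_sum]. *)
Lemma rotated_sum (R : realType) (p x y : R[i]) (N : nat) : x != 0 -> y != 0 ->
  y * (\sum_(z <- rotated_window N) theta_term p (x * y) z.1 * theta_term p (x / y) z.2)
  = even_sum p N x * odd_sum p N y - odd_sum p N x * even_sum p N y.
Proof.
move=> x0 y0; rewrite big_cat !big_allpairs_dep mulrDr /even_sum /odd_sum !big_distrlr /=.
have pw (m k : int) : (x * y) ^ m * (x / y) ^ k = x ^ (m + k) * y ^ (m - k).
  by rewrite !expfzMl exprz_inv !expfzDr // mulrACA.
have yS (k : int) : y ^ (k + 1) = y * y ^ k by rewrite expfzDr // expr1z mulrC.
rewrite -sumrN !mulr_sumr; congr (_ + _); apply: eq_bigr => i _.
  rewrite mulr_sumr; apply: eq_bigr => j _.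
  rewrite /theta_term mulrACA (theta_coefM _ _ _).1 pw yS.
  have -> : i + j + 1 + (i - j + 1) = 2 * i + 2 by ring.
  have -> : i + j + 1 - (i - j + 1) = 2 * j by ring.
  by ring.
rewrite -sumrN mulr_sumr; apply: eq_bigr => j _.
rewrite /theta_term mulrACA (theta_coefM _ _ _).2 pw.
have -> : i + j + 1 + (i - j) = 2 * i + 1 by ring.
have -> : i + j + 1 - (i - j) = 2 * j + 1 by ring.
have -> : 2 * j + 2 = (2 * j + 1) + 1 by ring.
by rewrite [y ^ (_ + 1 + 1)]yS; ring.
Qed.

(** The factor y makes the expression antisymmetric in x and y when |p| < 1 and x, y are nonzero, as
    befits a determinant. *)
Definition theta_det (R : realType) (p x y : R[i]) : R[i] :=
  y * theta (x * y) p * theta (x / y) p.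

Lemma cvgc_theta_det (R : realType) (p : R[i]) : normc p < 1 ->
  exists v : R[i], forall x y, x != 0 -> y != 0 ->
    cvgc (fun N => v * (even_sum p N x * odd_sum p N y - odd_sum p N x * even_sum p N y))
      (theta_det p x y).
Proof.
move=> p1; have [v v0 hv] := cvgc_theta p1.
exists (v * v) => x y x0 y0.
have xy0 : x * y != 0 by rewrite mulf_neq0.
have xVy0 : x / y != 0 by rewrite mulf_neq0 // invr_eq0.
have [_ [S hS thS]] := hv _ xy0; have [_ [T hT thT]] := hv _ xVy0.
have -> : theta_det p x y = v * v * (y * (S * T)) by rewrite /theta_det thS thT; ring.
rewrite (_ : (fun N => _) = fun N => v * v * (y *
  (\sum_(z <- rotated_window N) theta_term p (x * y) z.1 * theta_term p (x / y) z.2))); last first.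
  by apply/funext => N; rewrite rotated_sum.
apply: (cvgcM (cvgc_cst _) (cvgcM (cvgc_cst _) _)).
refine (@cvgc_sandwich R _ _ S T rotated_window (fun N => 2 * N + 3)%N _ _ hS hT _ _ _ _).
- exact: is_cvg_theta_term.
- exact: is_cvg_theta_term.
- by move=> n; lia.
- exact: uniq_rotated_window.
- exact: square_window_sub_rotated.
- exact: rotated_window_sub_square.
Qed.

(* The approximants of [theta_det] are 2 x 2 determinants, so they satisfy the
   Pluecker relation exactly. *)
Lemma theta_addition (R : realType) (p x y u z : R[i]) :
  normc p < 1 -> x != 0 -> y != 0 -> u != 0 -> z != 0 ->
  theta_det p x y * theta_det p u z - theta_det p x u * theta_det p y z
    + theta_det p x z * theta_det p y u = 0.
Proof.
move=> p1 x0 y0 u0 z0; have [v hv] := cvgc_theta_det p1.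
have h1 := cvgcM (hv _ _ x0 y0) (hv _ _ u0 z0).
have h2 := cvgcM (hv _ _ x0 u0) (hv _ _ y0 z0).
have h3 := cvgcM (hv _ _ x0 z0) (hv _ _ y0 u0).
have h4 := cvgcD (cvgcD h1 (cvgcM (cvgc_cst (-1)) h2)) h3.
rewrite -[theta_det p x u * _]mul1r -mulNr.
refine (cvgc_unique h4 (cvgc_cst 0) _) => N.
move: (even_sum p N) (odd_sum p N) => e o; ring.
Qed.

(** Inverting x exchanges the two kinds of factors up to the ends of the product: the first factors
    give -1/x, and the last ones, 1 - p^n x and 1 - p^n/x, tend to 1. *)
Lemma theta_inv (R : realType) (p x : R[i]) : normc p < 1 -> x != 0 ->
  theta x^-1 p = - (theta x p / x).
Proof.
move=> p1 x0; have [v _ hv] := cvgc_theta p1.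
have [hx _] := hv x x0; have [hVx _] : _ /\ _ := hv x^-1 (invr_neq0 x0).
have prodE n : x * (theta_prod p x^-1 n * (1 - p ^+ n * x^-1))
    = - (theta_prod p x n * (1 - p ^+ n * x)).
  rewrite /theta_prod invrK; elim: n => [|n IHn]; first by rewrite !big_nil !expr0; field.
  rewrite !big_nat_recr //=.
  transitivity (x * (\prod_(0 <= j < n) ((1 - p ^+ j * x^-1) * (1 - p ^+ j.+1 * x)) *
     (1 - p ^+ n * x^-1)) * ((1 - p ^+ n.+1 * x) * (1 - p ^+ n.+1 * x^-1))); first by ring.
  by rewrite IHn; ring.
have pn : cvgc (fun n => p ^+ n) 0.
  apply: (@cvgc_squeeze _ _ _ (fun n => normc p ^+ n)).
    by move=> n; rewrite subr0 normcX.
  by apply: cvg_expr; rewrite ger0_norm ?normc_ge0.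
have fac c : cvgc (fun n => 1 + (-1) * (p ^+ n * c)) 1.
  have := cvgcD (cvgc_cst 1) (cvgcM (cvgc_cst (-1)) (cvgcM pn (cvgc_cst c))).
  by rewrite mul0r mulr0 addr0.
have h1 := cvgcM (cvgc_cst x) (cvgcM hVx (fac x^-1)).
have h2 := cvgcM (cvgc_cst (-1)) (cvgcM hx (fac x)).
have h : x * theta x^-1 p = - theta x p.
  rewrite -[theta x^-1 p]mulr1 -[RHS]mulN1r -[theta x p]mulr1.
  by apply: (cvgc_unique h1 h2) => n; rewrite !mulN1r prodE.
by rewrite -mulNr -h mulrAC divff // mul1r.
Qed.

(** * Adding a column to a board *)

Lemma mem_skyline (c : seq nat) (x : nat * nat) :
  (x \in skyline c) = (0 < x.1 <= size c)%N && (0 < x.2 <= nth 0%N c x.1.-1)%N.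
Proof.
case: x => i j /=; rewrite in_fset /=; apply/allpairsPdep/andP => [[i' [j' []]]|[hi hj]].
  by rewrite !mem_iota => hi hj [-> ->]; lia.
by exists i, j; rewrite !mem_iota; split => //; lia.
Qed.

Lemma mem_skyline_rcons (c : seq nat) (m : nat) (x : nat * nat) :
  (x \in skyline (rcons c m)) =
  (x \in skyline c) || ((x.1 == (size c).+1) && (0 < x.2 <= m)%N).
Proof.
rewrite !mem_skyline size_rcons nth_rcons.
have [->|ne] := eqVneq x.1 (size c).+1; first by rewrite /= !ltnn eqxx leqnn.
rewrite orbF; have [h|h] := leqP x.1 (size c); last first.
  rewrite andbF /=; have -> : (x.1 <= (size c).+1)%N = false by lia.
  by rewrite andbF.
rewrite (leqW h); case: x.1 h {ne} => [|i] //= h.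
by rewrite h.
Qed.

Lemma file_placementsP (k : int) (B Q : {fset nat * nat}) :
  reflect [/\ Q `<=` B, (#|` Q|)%:Z = k
            & forall x y, x \in Q -> y \in Q -> x.1 = y.1 -> x = y]
          (Q \in file_placements k B).
Proof.
rewrite !inE /= fpowersetE; apply: (iffP and3P) => [[QB /eqP Qk h]|[QB Qk h]]; split => //.
- move=> x y xQ yQ xy; move/forallP: h => /(_ [` xQ])/forallP/(_ [` yQ])/implyP /=.
  by rewrite xy => /(_ (eqxx _))/eqP/(congr1 val).
- exact/eqP.
- apply/forallP => x; apply/forallP => y; apply/implyP => /eqP xy.
  by apply/eqP/val_inj/h => //; exact: valP.
Qed.

Lemma uncancelledP (B Q : {fset nat * nat}) (x : nat * nat) :
  reflect [/\ x \in B, x \notin Q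
            & forall y, y \in Q -> y.1 = x.1 -> (y.2 <= x.2)%N]
          (x \in uncancelled B Q).
Proof.
rewrite !inE /=; apply: (iffP and3P) => [[xB xQ h]|[xB xQ h]]; split => //.
- move=> y yQ yx; rewrite leqNgt; apply: contra h => xy.
  by apply/existsP; exists [` yQ]; rewrite /= yx eqxx.
- apply/existsP => -[y /andP[/eqP yx]]; rewrite ltnNge => /negP; apply.
  by apply: h => //; exact: valP.
Qed.

(** A placement with a rook in column n is recovered from the row r of that rook and the k - 1 rooks
    left on B; all others are placements on B. *)
Lemma file_placements_column (k : int) (n m : nat) (B B' : {fset nat * nat}) :
  (forall x, x \in B -> x.1 != n) ->
  (forall x, (x \in B') = (x \in B) || ((x.1 == n) && (0 < x.2 <= m)%N)) ->
  perm_eq (file_placements k B')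
    (file_placements k B ++
       [seq (n, r) |` Q | r <- iota 1 m, Q <- enum_fset (file_placements (k - 1) B)]).
Proof.
move=> nB memB'.
have notin j (Q : {fset nat * nat}) : Q `<=` B -> (n, j) \notin Q.
  by move=> /fsubsetP QB; apply/negP => /QB /nB; rewrite eqxx.
apply: uniq_perm; first exact: fset_uniq.
  rewrite cat_uniq fset_uniq /=; apply/andP; split.
    apply/hasPn => Q Qr; apply/negP => Q0.
    have /allpairsPdep[r [Q' [_ _ QE]]] : Q \in _ := Qr.
    have /file_placementsP[QB _ _] : Q \in file_placements k B := Q0.
    by move: (notin r Q QB); rewrite QE fset1U1.
  apply: allpairs_uniq; rewrite ?iota_uniq ?fset_uniq //.
  move=> [r Q] [r' Q'] /allpairsP[[r1 Q1] /= [_ h1 [-> ->]]] /allpairsP[[r2 Q2] /= [_ h2 [-> ->]]] E.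
  have /file_placementsP[Q1B _ _] : Q1 \in file_placements (k - 1) B := h1.
  have /file_placementsP[Q2B _ _] : Q2 \in file_placements (k - 1) B := h2.
  have r12 : r1 = r2.
    have : (n, r1) \in (n, r2) |` Q2 by rewrite -E fset1U1.
    by rewrite in_fset1U (negPf (notin _ _ Q2B)) orbF => /eqP[].
  move: E; rewrite r12 => E; congr (_, _).
  by rewrite -(fsetU1K (notin r2 _ Q1B)) E fsetU1K ?notin.
move=> Q; rewrite mem_cat; apply/idP/orP.
- move=> /file_placementsP[/fsubsetP QB' Qk Qinj].
  have [/hasP[x xQ /eqP xn]|/hasPn h] := boolP (has (fun x => x.1 == n) Q).
    right; have xB' := QB' _ xQ; move: xB'; rewrite memB' => /orP[/nB|/andP[_ xm]].
      by rewrite xn eqxx.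
    apply/allpairsPdep; exists x.2, (Q `\ x).
    have xE : x = (n, x.2) by rewrite -xn; case: (x).
    split; first by rewrite mem_iota add1n ltnS. 
      apply/file_placementsP; split.
      + apply/fsubsetP => y; rewrite in_fsetD1 => /andP[yx yQ].
        move: (QB' _ yQ); rewrite memB' => /orP[//|/andP[/eqP yn _]].
        by move/eqP: yx; case; apply: Qinj => //; rewrite xn yn.
      + by rewrite -Qk (cardfsD1 x Q) xQ; lia.
      + by move=> y z; rewrite !in_fsetD1 => /andP[_ yQ] /andP[_ zQ]; exact: Qinj.
    by rewrite -xE fsetD1K.
  left; apply/file_placementsP; split => //; apply/fsubsetP => x xQ.
  by move: (QB' _ xQ) (h _ xQ); rewrite memB' => /orP[//|/andP[/eqP->]]; rewrite eqxx.
- case=> [/file_placementsP[/fsubsetP QB Qk Qinj]|].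
    apply/file_placementsP; split => //; apply/fsubsetP => x /QB.
    by rewrite memB' => ->.
  move=> /allpairsPdep[r [Q' [hr hQ' ->]]].
  have /file_placementsP[Q'B Qk Qinj] : Q' \in file_placements (k - 1) B := hQ'.
  have nQ := notin _ _ Q'B; move/fsubsetP in Q'B; move: hr; rewrite mem_iota => hr.
  apply/file_placementsP; split.
  + apply/fsubsetP => x; rewrite in_fset1U memB' => /orP[/eqP->|/Q'B->//].
    by rewrite /= eqxx /=; apply/orP; right; lia.
  + by rewrite cardfsU1 nQ; lia.
  + move=> x y; rewrite !in_fset1U => /orP[/eqP->|xQ] /orP[/eqP->|yQ] //=.
    * by move=> yn; move: (nB _ (Q'B _ yQ)); rewrite -yn eqxx.
    * by move=> yn; move: (nB _ (Q'B _ xQ)); rewrite yn eqxx.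
    * exact: Qinj.
Qed.

(** Rows start at 1, so r = 0 encodes a column without rook, in which every cell survives; one
    statement thus covers both cases. *)
Lemma uncancelled_column (n m : nat) (B B' Q Q' : {fset nat * nat}) (r : nat) :
  (forall x, x \in B -> x.1 != n) ->
  (forall x, (x \in B') = (x \in B) || ((x.1 == n) && (0 < x.2 <= m)%N)) ->
  Q `<=` B -> (forall x, x.1 != n -> (x \in Q') = (x \in Q)) ->
  (forall j, ((n, j) \in Q') = ((0 < r)%N && (j == r))) ->
  perm_eq (uncancelled B' Q')
    (uncancelled B Q ++ [seq (n, j) | j <- iota 1 m & (r < j)%N]).
Proof.
move=> nB memB' /fsubsetP QB Q'Q Q'n.
apply: uniq_perm; first exact: fset_uniq.
  rewrite cat_uniq fset_uniq map_inj_uniq ?filter_uniq ?iota_uniq ?andbT //=; last by move=> i j [].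
  apply/hasPn => x /mapP[j _ ->]; apply/negP => h.
  have /uncancelledP[/nB] : (n, j) \in uncancelled B Q := h.
  by rewrite eqxx.
move=> [x1 x2]; rewrite mem_cat; apply/uncancelledP/orP.
- move=> [xB' xQ' hx]; move: xB'; rewrite memB' /= => /orP[xB|/andP[/eqP xn xm]].
    left; apply/uncancelledP; split => //; first by rewrite -Q'Q // nB.
    by move=> y yQ; apply: hx; rewrite Q'Q // nB // QB.
  right; move: xQ' hx; rewrite xn Q'n => h hx; apply: map_f.
  rewrite mem_filter mem_iota; case: r Q'n h => [|r] Q'n h; first by lia.
  have := hx (n, r.+1); rewrite Q'n eqxx => /(_ isT erefl) /=.
  by move: h => /=; lia.
- case=> [/uncancelledP[xB xQ hx]|/mapP[j]].
    have xn := nB _ xB; split; first by rewrite memB' xB.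
      by rewrite Q'Q.
    by move=> y yQ' yx; apply: hx => //; rewrite -Q'Q // yx.
  rewrite mem_filter mem_iota => /andP[rj jm] ->; split.
  + by rewrite memB' /= eqxx; apply/orP; right; lia.
  + by rewrite Q'n; lia.
  + by move=> [y1 y2] /= yQ' yn; move: yQ'; rewrite yn Q'n; lia.
Qed.

Lemma file_number_column (R : realType) (k : int) (a b q p : R[i]) (n m : nat)
    (B B' : {fset nat * nat}) :
  (forall x, x \in B -> x.1 != n) ->
  (forall x, (x \in B') = (x \in B) || ((x.1 == n) && (0 < x.2 <= m)%N)) ->
  file_number k a b q p B' =
    (\prod_(j <- iota 1 m) small_weight a b q p (1 - j%:Z)) * file_number k a b q p B
    + (\sum_(r <- iota 1 m) \prod_(j <- iota 1 m | (r < j)%N) small_weight a b q p (1 - j%:Z))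
      * file_number (k - 1) a b q p B.
Proof.
move=> nB memB'; rewrite /file_number (perm_big _ (file_placements_column k nB memB')).
rewrite big_cat big_allpairs_dep; congr (_ + _).
  rewrite mulr_sumr [LHS]big_seq [RHS]big_seq; apply: eq_bigr => Q hQ.
  have /file_placementsP[QB _ _] : Q \in file_placements k B := hQ.
  rewrite (perm_big _ (@uncancelled_column n m B B' Q Q 0 nB memB' QB _ _)) //; last first.
    by move=> j; apply/negP => /(fsubsetP QB)/nB; rewrite eqxx.
  rewrite big_cat big_map big_filter mulrC; congr (_ * _).
  by rewrite [LHS]big_seq_cond [RHS]big_seq; apply: eq_bigl => j; rewrite mem_iota; lia.
rewrite mulr_suml [LHS]big_seq [RHS]big_seq; apply: eq_bigr => r; rewrite mem_iota => hr.
rewrite mulr_sumr [LHS]big_seq [RHS]big_seq; apply: eq_bigr => Q hQ.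
have /file_placementsP[QB _ _] : Q \in file_placements (k - 1) B := hQ.
rewrite (perm_big _ (@uncancelled_column n m B B' Q ((n, r) |` Q) r nB memB' QB _ _)).
- by rewrite big_cat big_map big_filter mulrC.
- move=> x xn; rewrite in_fset1U; case: eqP => // xE.
  by move: xn; rewrite xE eqxx.
- move=> j; rewrite in_fset1U xpair_eqE eqxx /=.
  have -> : ((n, j) \in Q) = false by apply/negP => /(fsubsetP QB)/nB; rewrite eqxx.
  by lia.
Qed.

(** * Weights of a column *)

(** The instance of [theta_addition] that drives the induction on m for [m]. The points are x = s, y
    = q^(n+1)/s, u = s/q^n, z = bq/s with s^2 = a; the square root makes a appear in ratios such as
    x/y while products such as xy are free of it. *)
Lemma theta_difference (R : realType) (a b q p : R[i]) (n : int) :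
  normc p < 1 -> a != 0 -> b != 0 -> q != 0 ->
  theta (q ^ (n + 1)) p * theta (a * q ^ (- n - 1)) p
      * theta (b * q ^ (1 - n)) p * theta (a * q ^ (- n - 1) / b) p
    - q * (theta (q ^ n) p * theta (a * q ^ (- n)) p
      * theta (b * q ^ (- n)) p * theta (a * q ^ (- n - 2) / b) p)
  = theta q p * theta (b * q) p * theta (a * q ^ (- 1) / b) p
      * theta (a * q ^ (- 2 * n - 1)) p.
Proof.
move=> p1 a0 b0 q0; pose al := sqrtc a.
have alE : al * al = a by rewrite -expr2 sqr_sqrtc.
have al0 : al != 0 by apply: contraNneq a0 => al0; rewrite -alE al0 mulr0.
pose Q := q ^ n; have Q0 : Q != 0 by rewrite expfz_neq0.
have qD i : q ^ (n + i) = Q * q ^ i by rewrite expfzDr.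
have qB i : q ^ (- n + i) = Q^-1 * q ^ i by rewrite expfzDr // invr_expz.
have q2 : q ^ (- 2 * n - 1) = Q^-1 * Q^-1 * q^-1.
  have -> : - 2 * n - 1 = - n + (- n - 1) by ring.
  by rewrite !qB mulrA.
have -> : 1 - n = - n + 1 by ring.
rewrite qD !qB q2 -[q ^ (- n)]invr_expz -/Q !expr1z.
have -> : q ^ (- 1 : int) = q^-1 by [].
have -> : q ^ (- 2 : int) = q^-1 * q^-1 by rewrite -exprnN expr2 invfM.
have := @theta_addition _ p al (Q * q / al) (al / Q) (b * q / al) p1.
rewrite !mulf_neq0 ?invr_eq0 // => /(_ al0 isT isT isT).
rewrite /theta_det.
have -> : al * (Q * q / al) = Q * q by field; rewrite ?al0 ?b0 ?q0 ?Q0.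
have -> : al / (Q * q / al) = a * (Q^-1 * q^-1) by rewrite -alE; field; rewrite ?al0 ?b0 ?q0 ?Q0.
have -> : al / Q * (b * q / al) = b * (Q^-1 * q) by field; rewrite ?al0 ?b0 ?q0 ?Q0.
have -> : al / Q / (b * q / al) = a * (Q^-1 * q^-1) / b by rewrite -alE; field; rewrite ?al0 ?b0 ?q0 ?Q0.
have -> : al * (al / Q) = a * Q^-1 by rewrite -alE; field; rewrite ?al0 ?b0 ?q0 ?Q0.
have -> : al / (al / Q) = Q by field; rewrite ?al0 ?b0 ?q0 ?Q0.
have -> : Q * q / al * (b * q / al) = (a * (Q^-1 * (q^-1 * q^-1)) / b)^-1.
  by rewrite -alE; field; rewrite ?al0 ?b0 ?q0 ?Q0.
have -> : Q * q / al / (b * q / al) = (b * Q^-1)^-1 by field; rewrite ?al0 ?b0 ?q0 ?Q0.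
have -> : al * (b * q / al) = b * q by field; rewrite ?al0 ?b0 ?q0 ?Q0.
have -> : al / (b * q / al) = a * q^-1 / b by rewrite -alE; field; rewrite ?al0 ?b0 ?q0 ?Q0.
have -> : Q * q / al * (al / Q) = q by field; rewrite ?al0 ?b0 ?q0 ?Q0.
have -> : Q * q / al / (al / Q) = (a * (Q^-1 * Q^-1 * q^-1))^-1.
  by rewrite -alE; field; rewrite ?al0 ?b0 ?q0 ?Q0.
(* Three of the twelve arguments come out inverted; inversion brings them to the form of the
   statement. *)
rewrite !theta_inv // ?mulf_neq0 ?invr_eq0 ?mulf_neq0 ?invr_eq0 //.
rewrite -alE.
set t1 := theta (Q * q) p; set t2 := theta (_ * (Q^-1 * q^-1)) p.
set t3 := theta (b * (Q^-1 * q)) p; set t4 := theta (_ * (Q^-1 * q^-1) / b) p.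
set t5 := theta Q p; set t6 := theta (_ * Q^-1) p; set t7 := theta (b * Q^-1) p.
set t8 := theta (_ * (Q^-1 * (q^-1 * q^-1)) / b) p.
set t9 := theta q p; set t10 := theta (b * q) p; set t11 := theta (_ * q^-1 / b) p.
set t12 := theta (_ * (Q^-1 * Q^-1 * q^-1)) p.
move: t1 t2 t3 t4 t5 t6 t7 t8 t9 t10 t11 t12.
move=> t1 t2 t3 t4 t5 t6 t7 t8 t9 t10 t11 t12 H.
(* This is yz, the prefactor of the first product of determinants; multiplying the goal by it gives
   the addition formula. *)
have c0 : (Q * q * b * q / (al * al)) != 0 by rewrite !mulf_neq0 ?invr_eq0 ?mulf_neq0.
apply: (mulfI c0); apply/eqP; rewrite -subr_eq0 -[X in _ == X]H; apply/eqP.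
by field; rewrite ?al0 ?b0 ?q0 ?Q0.
Qed.

Lemma iota1S (m : nat) : iota 1 m.+1 = rcons (iota 1 m) m.+1.
Proof. by rewrite -[in LHS](addn1 m) iotaD cats1 add1n. Qed.

(** [TA], [TB], [TC] stand for theta(a q^(2k-1)), theta(b q^k) and theta(a q^k/b). In the weight,
    [TA] meets its shift by 1, leaving one factor at each end, while [TB] and [TC] meet shifts by 2,
    leaving two. *)
Lemma weight_prod_telescope (K : fieldType) (TA TB TC : int -> K) (q : K) (m : nat) :
  (forall k, TA k != 0) -> (forall k, TB k != 0) -> (forall k, TC k != 0) ->
  \prod_(j <- iota 1 m) (TA (1 - j%:Z + 1) * TB (1 - j%:Z) * TC (1 - j%:Z - 2)
    / (TA (1 - j%:Z) * TB (1 - j%:Z + 2) * TC (1 - j%:Z)) * q)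
  = TA 1 * TB (1 - m%:Z) * TB (2 - m%:Z) * TC (- m%:Z - 1) * TC (- m%:Z)
    / (TA (1 - m%:Z) * TB 1 * TB 2 * TC (- 1) * TC 0) * q ^+ m.
Proof.
move=> A0 B0 C0; elim: m => [|m IHm].
  rewrite big_nil !subr0 !oppr0 sub0r expr0.
  by field; rewrite ?A0 ?B0 ?C0.
rewrite iota1S big_rcons /= IHm exprS.
have -> : 1 - m.+1%:Z = - m%:Z by lia.
have -> : 2 - m.+1%:Z = 1 - m%:Z by lia.
have -> : - m.+1%:Z - 1 = - m%:Z - 2 by lia.
have -> : - m.+1%:Z = - m%:Z - 1 by lia.
have -> : - m%:Z + 1 = 1 - m%:Z by lia.
have -> : - m%:Z + 2 = 2 - m%:Z by lia.
by field; rewrite ?A0 ?B0 ?C0.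
Qed.

(** A new top row multiplies every earlier product by its weight, and a rook in that row contributes
    an empty product. *)
Lemma suffix_prod_sumS (K : pzRingType) (w : nat -> K) (m : nat) :
  \sum_(r <- iota 1 m.+1) \prod_(j <- iota 1 m.+1 | (r < j)%N) w j
    = (\sum_(r <- iota 1 m) \prod_(j <- iota 1 m | (r < j)%N) w j) * w m.+1 + 1.
Proof.
rewrite iota1S big_rcons /=; congr (_ + _).
  rewrite mulr_suml big_seq [RHS]big_seq; apply: eq_bigr => r; rewrite mem_iota => hr.
  by rewrite big_rcons /= ifT //; lia.
rewrite big_seq_cond big_pred0 // => j.
by rewrite mem_rcons inE mem_iota; lia.
Qed.

(** [TQ] and [TS] stand for theta(q^k) and theta(a q^k). By [suffix_prod_sumS] the sum satisfies
    S_(m+1) = S_m w(-m) + 1, and the last hypothesis says that the closed form does too. *)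
Lemma weight_sum_telescope (K : fieldType) (TA TB TC TQ TS : int -> K) (q : K) (m : nat) :
  (forall k, TA k != 0) -> (forall k, TB k != 0) -> (forall k, TC k != 0) ->
  TQ 0 = 0 -> TQ 1 != 0 ->
  (forall n, TQ (n + 1) * TS (- n - 1) * TB (1 - n) * TC (- n - 1)
     - q * (TQ n * TS (- n) * TB (- n) * TC (- n - 2))
     = TQ 1 * TB 1 * TC (- 1) * TA (- n)) ->
  \sum_(r <- iota 1 m) \prod_(j <- iota 1 m | (r < j)%N)
    (TA (1 - j%:Z + 1) * TB (1 - j%:Z) * TC (1 - j%:Z - 2)
    / (TA (1 - j%:Z) * TB (1 - j%:Z + 2) * TC (1 - j%:Z)) * q)
  = TQ m%:Z * TS (- m%:Z) * TB (2 - m%:Z) * TC (- m%:Z)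
    / (TQ 1 * TA (1 - m%:Z) * TB 1 * TC (- 1)).
Proof.
move=> A0 B0 C0 Q0 Q1 diff; elim: m => [|m IHm].
  by rewrite big_nil Q0 !mul0r.
rewrite suffix_prod_sumS IHm.
have -> : 1 - m.+1%:Z = - m%:Z by lia.
have -> : 2 - m.+1%:Z = 1 - m%:Z by lia.
have -> : - m.+1%:Z = - m%:Z - 1 by lia.
have -> : - m%:Z + 1 = 1 - m%:Z by lia.
have -> : - m%:Z + 2 = 2 - m%:Z by lia.
have -> : (m.+1%:Z = m%:Z + 1)%R by lia.
have TAm : TA (- m%:Z) = (TQ (m%:Z + 1) * TS (- m%:Z - 1) * TB (1 - m%:Z) * TC (- m%:Z - 1)
     - q * (TQ m%:Z * TS (- m%:Z) * TB (- m%:Z) * TC (- m%:Z - 2))) / (TQ 1 * TB 1 * TC (- 1)).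
  by rewrite diff; field; rewrite ?Q1 ?B0 ?C0.
apply/eqP; rewrite -subr_eq0; apply/eqP.
(* Over a common denominator, the difference of the two sides is the defect of the difference
   relation at n = m. *)
transitivity ((TQ 1 * TB 1 * TC (- 1) * TA (- m%:Z) -
   (TQ (m%:Z + 1) * TS (- m%:Z - 1) * TB (1 - m%:Z) * TC (- m%:Z - 1)
     - q * (TQ m%:Z * TS (- m%:Z) * TB (- m%:Z) * TC (- m%:Z - 2))))
   / (TQ 1 * TB 1 * TC (- 1) * TA (- m%:Z))).
  by field; rewrite ?A0 ?Q1 ?B0 ?C0.
by rewrite diff subrr mul0r.
Qed.

(** As 1 is its own inverse, [theta_inv] gives theta(1) = -theta(1). *)
Lemma theta1 (R : realType) (p : R[i]) : normc p < 1 -> theta 1 p = 0.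
Proof.
move=> p1; have := theta_inv p1 (oner_neq0 _); rewrite !invr1 mulr1 => /eqP.
by rewrite -addr_eq0 -mulr2n mulrn_eq0 /= => /eqP.
Qed.

Lemma generic_theta_neq0 (R : realType) (a b q p : R[i]) (k : int) :
  generic a b q p ->
  [/\ theta (a * q ^ (2 * k - 1)) p != 0, theta (b * q ^ k) p != 0
    & theta (a * q ^ k / b) p != 0].
Proof.
(* The factor theta(b q^k) occurs in [w_den] at k - 2, the other two at k. *)
move=> [_ gen]; have := gen (k - 2); have := gen k.
rewrite /w_den /thetas !big_cons !big_nil !mulr1 subrK !mulf_eq0 !negb_or.
by move=> /and3P[? _ ?] /and3P[_ ? _].
Qed.

(** Reading 2k + 1 as 2(k+1) - 1 exhibits the first numerator factor as the first denominator factor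
    at k + 1, the shape needed for telescoping. *)
Lemma small_weightE (R : realType) (a b q p : R[i]) (k : int) :
  small_weight a b q p k =
    theta (a * q ^ (2 * (k + 1) - 1)) p * theta (b * q ^ k) p * theta (a * q ^ (k - 2) / b) p
    / (theta (a * q ^ (2 * k - 1)) p * theta (b * q ^ (k + 2)) p * theta (a * q ^ k / b) p) * q.
Proof.
rewrite /small_weight /w_num /w_den /thetas !big_cons !big_nil !mulr1 !mulrA.
by have -> : 2 * k + 1 = 2 * (k + 1) - 1 by ring.
Qed.

Lemma shifted_theta (R : realType) (a b q p : R[i]) (m i : int) : q != 0 ->
  [/\ theta (a * q ^ (- (2 * m)) * q ^ i) p = theta (a * q ^ (i - 2 * m)) p,
      theta (b * q ^ (- m) * q ^ i) p = theta (b * q ^ (i - m)) p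
    & theta (a * q ^ (- (2 * m)) * q ^ i / (b * q ^ (- m))) p = theta (a * q ^ (i - m) / b) p].
Proof.
move=> q0; split.
- by rewrite -mulrA -expfzDr // addrC.
- by rewrite -mulrA -expfzDr // addrC.
- rewrite invfM invr_expz opprK.
  have -> : i - m = - (2 * m) + i + m by ring.
  by congr (theta _ p); rewrite !expfzDr //; ring.
Qed.

Lemma big_weightE (R : realType) (a b q p : R[i]) (m : nat) :
  q != 0 -> generic a b q p ->
  big_weight (a * q ^ (- (2 * m%:Z))) (b * q ^ (- m%:Z)) q p m%:Z
  = \prod_(j <- iota 1 m) small_weight a b q p (1 - j%:Z).
Proof.
move=> q0 gen.
have g k := generic_theta_neq0 k gen.
under eq_bigr do rewrite small_weightE.
rewrite (@weight_prod_telescope _ (fun k => theta (a * q ^ (2 * k - 1)) p)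
  (fun k => theta (b * q ^ k) p) (fun k => theta (a * q ^ k / b) p)); first last.
- by move=> k; case: (g k).
- by move=> k; case: (g k).
- by move=> k; case: (g k).
have sA i := let: And3 h _ _ := shifted_theta a b p m%:Z i q0 in h.
have sB i := let: And3 _ h _ := shifted_theta a b p m%:Z i q0 in h.
have sC i := let: And3 _ _ h := shifted_theta a b p m%:Z i q0 in h.
(* Factors written with q itself or with no power of q are the shifts i = 1 and i = 0. *)
have A1 := sA 1; have B1 := sB 1; have C0 := sC 0.
rewrite expr1z in A1 B1; rewrite expr0z mulr1 in C0.
rewrite /big_weight /thetas !big_cons !big_nil !mulr1.
rewrite A1 B1 C0 !sA !sB !sC.
have -> : 1 + 2 * m%:Z - 2 * m%:Z = 2 - 1 by lia.
have -> : 1 - 2 * m%:Z = 2 * (1 - m%:Z) - 1 by lia.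
have -> : m%:Z + 1 - m%:Z = 1 by lia.
have -> : m%:Z + 2 - m%:Z = 2 by lia.
have -> : m%:Z - 1 - m%:Z = - 1 by lia.
have -> : m%:Z - m%:Z = 0 by lia.
have -> : - 1 - m%:Z = - m%:Z - 1 by lia.
by rewrite !sub0r expr0z mulr1 !mulrA.
Qed.

Lemma elliptic_numberE (R : realType) (a b q p : R[i]) (m : nat) :
  normc p < 1 -> a != 0 -> b != 0 -> q != 0 -> generic a b q p ->
  elliptic_number (a * q ^ (- (2 * m%:Z))) (b * q ^ (- m%:Z)) q p m%:Z
  = \sum_(r <- iota 1 m) \prod_(j <- iota 1 m | (r < j)%N)
      small_weight a b q p (1 - j%:Z).
Proof.
move=> p1 a0 b0 q0 gen.
have g k := generic_theta_neq0 k gen.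
under eq_bigr do under eq_bigr do rewrite small_weightE.
rewrite (@weight_sum_telescope _ (fun k => theta (a * q ^ (2 * k - 1)) p)
  (fun k => theta (b * q ^ k) p) (fun k => theta (a * q ^ k / b) p)
  (fun k => theta (q ^ k) p) (fun k => theta (a * q ^ k) p)); first last.
- move=> n; have -> : 2 * - n - 1 = - 2 * n - 1 by ring.
  by rewrite !expr1z; exact: theta_difference.
- by rewrite expr1z; case: gen.
- by rewrite expr0z theta1.
- by move=> k; case: (g k).
- by move=> k; case: (g k).
- by move=> k; case: (g k).
have sA i := let: And3 h _ _ := shifted_theta a b p m%:Z i q0 in h.
have sB i := let: And3 _ h _ := shifted_theta a b p m%:Z i q0 in h.
have sC i := let: And3 _ _ h := shifted_theta a b p m%:Z i q0 in h.
have A1 := sA 1; have C0 := sC 0.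
rewrite expr1z in A1; rewrite expr0z mulr1 in C0.
rewrite /elliptic_number /thetas !big_cons !big_nil !mulr1 expr1z.
rewrite A1 C0 !sA !sB !sC.
have -> : 1 - 2 * m%:Z = 2 * (1 - m%:Z) - 1 by lia.
have -> : m%:Z + 1 - m%:Z = 1 by lia.
have -> : m%:Z - 1 - m%:Z = - 1 by lia.
have -> : m%:Z - 2 * m%:Z = - m%:Z by lia.
by rewrite !sub0r expr1z !mulrA.
Qed.

Theorem theorem5p5 (R : realType) (a b q p : R[i])
  (a_neq0 : a != 0) (b_neq0 : b != 0) (q_neq0 : q != 0) (p_lt1 : `|p| < 1)
  (gen : generic a b q p) (c : seq nat) (m : nat) :
  [/\ forall k : int, k < 0 -> file_number k a b q p (skyline c) = 0,
      skyline c = fset0 -> file_number 0 a b q p (skyline c) = 1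
    & forall k : int,
        file_number k a b q p (skyline (rcons c m)) =
          big_weight (a * q ^ (- (2 * m%:Z))) (b * q ^ (- m%:Z)) q p m%:Z
            * file_number k a b q p (skyline c)
          + elliptic_number (a * q ^ (- (2 * m%:Z))) (b * q ^ (- m%:Z)) q p m%:Z
            * file_number (k - 1) a b q p (skyline c)].
Proof.
have p1 : normc p < 1 by rewrite -ltcR -normrcE.
split=> [k k0|->|k].
- rewrite /file_number big_seq big1 // => Q /file_placementsP[_ Qk _].
  by move: k0; rewrite -Qk.
- have mem0 (Q : {fset nat * nat}) : (Q \in file_placements 0 fset0) = (Q == fset0).
    apply/file_placementsP/eqP => [[]|->]; first by rewrite fsubset0 => /eqP.
    by split=> // x y; rewrite inE.
  rewrite /file_number (perm_big [:: fset0]); last first.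
    apply: uniq_perm => //; first exact: fset_uniq.
    by move=> Q; rewrite mem_seq1; exact: mem0.
  rewrite big_seq1 big_seq big1 // => x /uncancelledP[].
  by rewrite inE.
- rewrite big_weightE // elliptic_numberE //.
  (* Columns are numbered from 1, so the added one is number [(size c).+1]. *)
  apply: (@file_number_column _ k a b q p (size c).+1 m).
    move=> x; rewrite mem_skyline => /andP[/andP[_ xc] _].
    by rewrite neq_ltn ltnS xc.
  exact: mem_skyline_rcons.
Qed.
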